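(* Let $\{A,B\}$ be an adjoint pair on a Hilbert space $\mathcal{H}$ such that $0$ is a regular point for $A$ and $B$, and suppose that $B$ is a closed formally normal operator and $\mathcal{D}(A)=\mathcal{D}(B)$. Let $R$ be the associated operator described in the context. For every closed linear subspace $\mathcal{C}$ of $\mathcal{K}=\mathcal{N}(A^* )\oplus\mathcal{N}(B^* )$, the operator $T_{\mathcal{C}}$ is a proper extension of $B$, that is, $T_{\mathcal{C}}$ is a closed linear operator such that $B\subseteq T_{\mathcal{C}}\subseteq A^*$. Each proper extension of $B$ is of the form $T_{\mathcal{C}}$ for some closed linear subspace $\mathcal{C}$ of $\mathcal{K}$. Further, $$(T_{\mathcal{C}})^*=S_{\mathcal{C}'}\quad\text{and}\quad (S_{\mathcal{C}'})^*=T_{\mathcal{C}}.$$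
   Context: $\mathcal{D}(T)$ and $\mathcal{N}(T)$ denote the domain and the kernel of an operator $T$; $\dot{+}$ is the direct sum of vector spaces; $T\lceil\mathcal{D}$ is the restriction of $T$ to $\mathcal{D}$. An adjoint pair $\{A,B\}$ is a pair of densely defined linear operators on $\mathcal{H}$ with $\langle Ax,y\rangle=\langle x,By\rangle$ for $x\in\mathcal{D}(A)$, $y\in\mathcal{D}(B)$. The number $0$ is a regular point for $T$ if there is $\gamma>0$ with $\|T\varphi\|\ge\gamma\|\varphi\|$ for all $\varphi\in\mathcal{D}(T)$. A densely defined operator $T$ is formally normal if $\mathcal{D}(T)\subseteq\mathcal{D}(T^* )$ and $\|Tx\|=\|T^*x\|$ for $x\in\mathcal{D}(T)$. A proper extension of $B$ is a closed operator $T$ on $\mathcal{H}$ with $B\subseteq T\subseteq A^*$. Associated operator $R$: a fixed closed operator $R$ on $\mathcal{H}$ such that $R$ and $R^*$ have bounded everywhere defined inverses, $A\subseteq R\subseteq B^*$, $B\subseteq R^*\subseteq A^*$ (it exists by a theorem of Vishik); it satisfies $$\mathcal{D}(A^* )=\mathcal{D}(B)\dot{+}(R^* )^{-1}\mathcal{N}(B^* )\dot{+}\mathcal{N}(A^* ),\qquad \mathcal{D}(B^* )=\mathcal{D}(A)\dot{+}R^{-1}\mathcal{N}(A^* )\dot{+}\mathcal{N}(B^* ).$$ For a closed subspace $\mathcal{C}$ of $\mathcal{K}$ set $T_{\mathcal{C}}=A^*\lceil\mathcal{D}(T_{\mathcal{C}})$ and $S_{\mathcal{C}}=B^*\lceil\mathcal{D}(S_{\mathcal{C}})$,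 where $$\mathcal{D}(T_{\mathcal{C}})=\{x_0+(R^* )^{-1}v_1+u_1:\ x_0\in\mathcal{D}(B),\ (u_1,v_1)\in\mathcal{C}\},$$ $$\mathcal{D}(S_{\mathcal{C}})=\{y_0+R^{-1}u_2+v_2:\ y_0\in\mathcal{D}(A),\ (u_2,v_2)\in\mathcal{C}\},$$ and let $\mathcal{C}'=\{(u_2,v_2)\in\mathcal{K}:\ \langle v_1,v_2\rangle=\langle u_1,u_2\rangle\ \text{for all}\ (u_1,v_1)\in\mathcal{C}\}$, which is a closed linear subspace of $\mathcal{K}$. *)

(* Defs.v *)
From HB Require Import structures.
From mathcomp Require Import all_boot all_order all_algebra.
From mathcomp Require Import complex.
From mathcomp Require Import all_classical all_reals all_analysis.

Set Implicit Arguments.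
Unset Strict Implicit.
Unset Printing Implicit Defensive.

Import Order.TTheory GRing.Theory Num.Theory.
Import numFieldNormedType.Exports.

Local Open Scope classical_set_scope.
Local Open Scope complex_scope.
Local Open Scope ring_scope.

(* Complex Hilbert spaces.  {dot H for Num.conj} is the type of positive definite
   Hermitian forms, linear in the first and conjugate-linear in the second
   argument. *)
HB.mixin Record isHilbert (F : realType) H of CompleteNormedModule F[i] H := {
  inner : {dot H for @Num.conj F[i]} ;
  inner_norm : forall x : H, inner x x = `|x| ^+ 2
}.

#[short(type="hilbertType")]
HB.structure Definition Hilbert (F : realType) :=
  {H of CompleteNormedModule F[i] H & isHilbert F H}.

Notation "'<| x , y |>" := (inner x y)
  (at level 0, x, y at level 99, format "''<|' x ,  y '|>'") : ring_scope.

(* A (possibly unbounded, possibly partial) operator on H is identified with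
   its graph, a subset of H * H: thus inclusion and equality of operators are
   those of sets, and closedness is that of the graph in H * H. *)
Section operators.
Variables (F : realType) (H : hilbertType F).
Implicit Types (T : set (H * H)) (D : set H).

Definition is_operator T :=
  submod_closed (mem T) /\ forall x y y', T (x, y) -> T (x, y') -> y = y'.

Definition domain T : set H := [set x | exists y, T (x, y)].

Definition kernel T : set H := [set x | T (x, 0)].

Definition restriction T D : set (H * H) := [set p | T p /\ D p.1].

Definition inverse T : set (H * H) := [set p | T (p.2, p.1)].

(* This is the graph of an operator exactly when T is densely defined. *)
Definition adjoint T : set (H * H) :=
  [set p | forall x y, T (x, y) -> '<| y, p.1 |> = '<| x, p.2 |>].

Definition bounded_everywhere_defined T :=
  [/\ is_operator T, domain T = setT &
      exists M : F, forall x y, T (x, y) -> `|y| <= M%:C * `|x|].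

Definition zero_regular T :=
  exists2 gamma : F, 0 < gamma &
    forall x y, T (x, y) -> gamma%:C * `|x| <= `|y|.

Definition formally_normal T :=
  [/\ is_operator T, dense (domain T), domain T `<=` domain (adjoint T) &
      forall x y z, T (x, y) -> adjoint T (x, z) -> `|y| = `|z|].

Definition adjoint_pair (A B : set (H * H)) :=
  [/\ is_operator A /\ dense (domain A), is_operator B /\ dense (domain B) &
      forall x Ax y By, A (x, Ax) -> B (y, By) -> '<| Ax, y |> = '<| x, By |>].

Definition proper_extension (A B T : set (H * H)) :=
  [/\ is_operator T, closed T, B `<=` T & T `<=` adjoint A].

Definition associated (A B R : set (H * H)) :=
  [/\ is_operator R /\ closed R,
      bounded_everywhere_defined (inverse R),
      bounded_everywhere_defined (inverse (adjoint R)),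
      A `<=` R /\ R `<=` adjoint B &
      B `<=` adjoint R /\ adjoint R `<=` adjoint A].

Definition defect_space (A B : set (H * H)) : set (H * H) :=
  kernel (adjoint A) `*` kernel (adjoint B).

(* For K = defect_space A B, which is closed in H * H as a product of kernels
   of adjoints, closed in K and closed in H * H mean the same. *)
Definition closed_subspace_of (K C : set (H * H)) :=
  [/\ C `<=` K, submod_closed (mem C) & closed C].

Definition T_ (A B R C : set (H * H)) : set (H * H) :=
  restriction (adjoint A)
    [set x | exists x0 u1 v1 w1, [/\ domain B x0, C (u1, v1),
       inverse (adjoint R) (v1, w1) & x = x0 + w1 + u1]].

Definition S_ (A B R C : set (H * H)) : set (H * H) :=
  restriction (adjoint B)
    [set y | exists y0 u2 v2 w2, [/\ domain A y0, C (u2, v2),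
       inverse R (u2, w2) & y = y0 + w2 + v2]].

Definition prime_subspace (A B C : set (H * H)) : set (H * H) :=
  [set p | defect_space A B p /\
     forall u1 v1, C (u1, v1) -> '<| v1, p.2 |> = '<| u1, p.1 |>].

End operators.

(* Main.v *)
Require Import Defs.
From mathcomp Require Import all_boot all_order all_algebra.
From mathcomp Require Import complex lra ring.
From mathcomp Require Import all_classical all_reals all_analysis.

Set Implicit Arguments.
Unset Strict Implicit.
Unset Printing Implicit Defensive.

Import Order.TTheory GRing.Theory Num.Theory.
Import numFieldNormedType.Exports.

Local Open Scope classical_set_scope.
Local Open Scope complex_scope.
Local Open Scope ring_scope.

(** The key is Green's identity.  If x = x0 + w1 + u1 and y = y0 + w2 + v2 with
    x0 in D(B), R^* w1 = v1, y0 in D(A), R w2 = u2, then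
    [<A^* x, y> - <x, B^* y> = <v1, v2> - <u1, u2>]:
    all the other terms cancel because A and B, and also R and R^*, are formally
    adjoint, and because u1, v2 lie in the kernels of A^*, B^*
    ([extension_pairing]).  So y belongs to the domain of (T_C)^* as soon as its
    parameter (u2, v2) is in C', and conversely once y is known to have such a
    decomposition.

    Every y in D(B^* ) does ([adjoint_decomposition]): B^* y is split along the
    range of A and its orthogonal complement, the kernel of A^*, the two parts are
    lifted by A and by R, and the remainder is in the kernel of B^*.  This asks
    that the ranges of A and B be closed.  For B that is regularity of 0 and
    closedness; for A, which is not supposed closed, formal normality gives
    |Ax| = |B^* x| = |Bx| on the common domain, so limits in the range of A are
    controlled by the graph of B ([range_complete]).

    Both adjoint formulas are the same lemma ([adjoint_extension]), applied once
    to (A, B, R, R^* ) and once to (B, A, R^*, R), since a closed C satisfies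
    C'' = C ([dual_subspaceK]): the sign change (u, v) -> (-u, v) turns C' into
    the orthogonal complement of C in the space of parameters.
    As an adjoint, T_C is closed.  Conversely a proper extension T is recovered
    from the parameters (u, v) with (R^* )^-1 v + u in D(T); they form a closed
    subspace because (R^* )^-1 is continuous ([parameters_closed_subspace]).

    Orthogonal projections are needed both in H, onto a range, and in H * H, onto
    C.  They are obtained together from a projection theorem for real positive
    symmetric forms ([form_projection]), used with the real part of the inner
    product and with the sum of its two copies. *)

(** * Subspaces and projection for a positive symmetric form *)

Lemma submod_closedP (K : pzRingType) (E : lmodType K) (M : set E) :
  submod_closed (mem M) <->
  M 0 /\ forall a x y, M x -> M y -> M (a *: x + y).
Proof.
split=> [[M0 ML]|[M0 ML]].
  split=> [|a x y Mx My]; first by move: M0; rewrite inE.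
  by have := ML a x y; rewrite !inE; apply.
split=> [|a x y]; rewrite !inE //; exact: ML.
Qed.

Section submod.
Variables (K : pzRingType) (E : lmodType K) (M : set E).
Hypothesis subM : submod_closed (mem M).

Lemma submod0 : M 0.
Proof. by have [] := (submod_closedP M).1 subM. Qed.

Lemma submodD x y : M x -> M y -> M (x + y).
Proof.
by have [_ +] := (submod_closedP M).1 subM => /(_ 1 x y); rewrite scale1r.
Qed.

Lemma submodZ a x : M x -> M (a *: x).
Proof.
have [M0 +] := (submod_closedP M).1 subM => /(_ a x 0) /[swap] Mx.
by rewrite addr0; apply.
Qed.

Lemma submodB x y : M x -> M y -> M (x - y).
Proof.
by move=> Mx My; rewrite -scaleN1r; apply: submodD => //; exact: submodZ.
Qed.

End submod.

Section real_form.
Variables (F : realType) (E : lmodType F[i]) (r : E -> E -> F).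

(** The values are real so that distances to a subspace have an infimum, and the
    form is not tied to a norm on E because the norm of H * H, a maximum, comes
    from no inner product. *)
Record real_semi_inner : Prop := RealSemiInner {
  formDl : forall x y z, r (x + y) z = r x z + r y z ;
  formC : forall x y, r x y = r y x ;
  formZl : forall (t : F) x y, r (t%:C *: x) y = t * r x y ;
  form_ge0 : forall x, 0 <= r x x
}.

Definition form_cauchy (u : nat -> E) := forall e : F, 0 < e ->
  exists N, forall m n, (N <= m)%N -> (N <= n)%N ->
    r (u m - u n) (u m - u n) < e.

Definition form_cvg (u : nat -> E) l := forall e : F, 0 < e ->
  exists N, forall n, (N <= n)%N -> r (u n - l) (u n - l) < e.

(** Completeness is asked of the subset alone, so that it can be checked on the
    range of an operator without comparing the topologies of form and norm. *)
Definition form_complete (M : set E) := forall u, (forall n, M (u n)) ->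
  form_cauchy u -> exists2 l, M l & form_cvg u l.

Hypothesis rP : real_semi_inner.

Let formNl x y : r (- x) y = - r x y.
Proof.
by rewrite -scaleN1r -[-1](rmorphN1 (real_complex F)) formZl// mulN1r.
Qed.

Let form_subZ x y (t : F) : r (x - t%:C *: y) (x - t%:C *: y)
  = r x x - 2 * t * r x y + t ^+ 2 * r y y.
Proof.
have e z w v : r (z - t%:C *: w) v = r z v - t * r w v.
  by rewrite formDl// formNl formZl.
rewrite e ![r _ (x - _)](formC rP) !e (formC rP y x); ring.
Qed.

(** If d bounds from below the squared lengths along the line x - t y, then the
    discriminant of this quadratic polynomial of t minus d is nonpositive.  With
    d = 0 this is the Cauchy-Schwarz inequality; with d the squared distance of
    x to a subspace containing y, it says that a nearly closest point is nearly
    orthogonal to y. *)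
Lemma form_gap x y d :
  (forall t : F, d <= r (x - t%:C *: y) (x - t%:C *: y)) ->
  r x y ^+ 2 <= (r x x - d) * r y y.
Proof.
move=> dP; have [y0|yN0] := eqVneq (r y y) 0.
  rewrite y0 mulr0; have [->|rN0] := eqVneq (r x y) 0; first by rewrite expr0n.
  (* The polynomial is affine and takes the value d - 1 at this t. *)
  have := dP ((r x x - d + 1) / (2 * r x y)).
  have -> : r (x - ((r x x - d + 1) / (2 * r x y))%:C *: y)
      (x - ((r x x - d + 1) / (2 * r x y))%:C *: y) = d - 1.
    by rewrite form_subZ y0; field; rewrite rN0.
  lra.
have y0 : 0 < r y y by rewrite lt_def yN0 form_ge0.
have := dP (r x y / r y y); rewrite form_subZ.
have -> : r x x - 2 * (r x y / r y y) * r x y + (r x y / r y y) ^+ 2 * r y y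
  = r x x - r x y ^+ 2 / r y y by field.
by rewrite lerBrDr addrC -lerBrDr ler_pdivrMr.
Qed.

Lemma form_cauchy_schwarz x y : r x y ^+ 2 <= r x x * r y y.
Proof. by rewrite -[r x x]subr0; apply: form_gap => t; exact: form_ge0. Qed.

Let form_parallelogram x y : r (x - y) (x - y) + r (x + y) (x + y)
  = 2 * r x x + 2 * r y y.
Proof.
have := form_subZ x y 1; have := form_subZ x y (- 1).
rewrite rmorphN1 scaleN1r opprK rmorph1 scale1r => -> ->; ring.
Qed.

(** A minimizing sequence is Cauchy by the parallelogram identity; its limit m
    is orthogonal because [form_gap] controls r (x - u n) y by how far u n is
    from minimizing, and r (u n - m) y by the convergence of u. *)
Lemma form_projection (M : set E) (x : E) :
  submod_closed (mem M) -> form_complete M ->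
  exists2 m, M m & forall y, M y -> r (x - m) y = 0.
Proof.
move=> subM complM; set D := [set r (x - m) (x - m) | m in M].
have infD : has_inf D.
  split; first by exists (r (x - 0) (x - 0)), 0 => //; exact: submod0.
  by exists 0 => _ [m _ <-]; exact: form_ge0.
have lbD m : M m -> inf D <= r (x - m) (x - m).
  by move=> Mm; apply: ge_inf; [exact: infD.2|exists m].
have minseq n : exists m, M m /\ r (x - m) (x - m) < inf D + n.+1%:R^-1.
  have [|_ [m Mm <-] lt_m] := @inf_adherent _ _ n.+1%:R^-1 _ infD.
    by rewrite invr_gt0.
  by exists m.
have [u uP] := choice minseq.
have Mu n : M (u n) by have [] := uP n.
have small (e : F) : 0 < e ->
    exists N, forall n, (N <= n)%N -> n.+1%:R^-1 < e :> F.
  move=> e0; have [N Ne] := ltr_add_invr e0.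
  exists N => n Nn; apply: le_lt_trans Ne; rewrite add0r.
  by rewrite lef_pV2 ?posrE// ler_nat ltnS.
have u_cauchy : form_cauchy u.
  move=> e e0; have [|N NP] := small (e / 4); first lra.
  exists N => m n /NP m4 /NP n4.
  have [_ um] := uP m; have [_ un] := uP n.
  have Mmn : M (2^-1%:C *: (u m + u n)) by apply: submodZ => //; exact: submodD.
  have := lbD _ Mmn.
  have := form_parallelogram (x - u n) (x - u m).
  have -> : x - u n - (x - u m) = u m - u n.
    by rewrite opprB addrC subrKA.
  have -> : x - u n + (x - u m) = 2%:C *: (x - 2^-1%:C *: (u m + u n)).
    rewrite scalerBr scalerA -rmorphM/= divff// scale1r.
    rewrite (rmorphMn (real_complex F) 2) scaler_nat.
    by rewrite mulr2n opprD addrACA [in RHS](addrC (- u m)).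
  rewrite formZl// (formC rP _ (2%:C *: _)) formZl//.
  move: um un m4 n4 => + + + +.
  move: (m.+1%:R^-1) (n.+1%:R^-1) (r _ _) (r _ _) (r _ _) (r _ _).
  move: (inf D) => d i j r0 r1 r2 r3; lra.
have [m Mm um] := complM u Mu u_cauchy.
exists m => // y My.
apply/eqP; rewrite -sqrf_eq0; apply/eqP/le_anti; rewrite sqr_ge0 andbT.
apply/ler_addgt0Pl => e e0; rewrite addr0.
have q0 := form_ge0 rP y.
(* (s + t)^2 <= 2 s^2 + 2 t^2 is at most 4 (e / c) (r y y), hence the choice
   of c; adding 1 keeps it positive. *)
set c := 4 * (r y y + 1); have c0 : 0 < c by rewrite /c; lra.
have [N1 N1P] := small (e / c) (divr_gt0 e0 c0).
have [N2 N2P] := um (e / c) (divr_gt0 e0 c0).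
set n := maxn N1 N2.
have := N1P n (leq_maxl _ _); have := N2P n (leq_maxr _ _).
set a := r (u n - m) (u n - m); set b := n.+1%:R^-1.
rewrite !ltr_pdivlMr// => ae be.
have [_] := uP n; rewrite -/b => unb.
have h1 : r (x - u n) y ^+ 2 <= (r (x - u n) (x - u n) - inf D) * r y y.
  apply: form_gap => t; rewrite -addrA -opprD; apply: lbD.
  by apply: submodD => //; exact: submodZ.
have h2 : r (u n - m) y ^+ 2 <= a * r y y := form_cauchy_schwarz _ _.
have -> : r (x - m) y = r (x - u n) y + r (u n - m) y.
  by rewrite -formDl// subrKA.
have a0 : 0 <= a by exact: form_ge0.
have b0 : 0 < b by rewrite invr_gt0.
have h3 : (r (x - u n) (x - u n) - inf D) * r y y <= b * r y y.
  by apply: ler_wpM2r => //; lra.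
move: h1 h2 h3 ae be; rewrite /c.
set s := r (x - u n) y; set t := r (u n - m) y.
have : 0 <= (s - t) ^+ 2 := sqr_ge0 _.
move: (r y y) q0 (r _ _ - _) a0 b0 => q q0 g a0 b0.
nra.
Qed.

End real_form.

(** * Inner product, completeness and orthogonality *)

Section hilbert.
Variables (F : realType) (H : hilbertType F).
Implicit Types x y z : H.

Lemma innerBl x y z : '<| x - y, z |> = '<| x, z |> - '<| y, z |>.
Proof. exact: linearBl. Qed.

Lemma innerDl x y z : '<| x + y, z |> = '<| x, z |> + '<| y, z |>.
Proof. exact: linearDl. Qed.

Lemma innerDr x y z : '<| x, y + z |> = '<| x, y |> + '<| x, z |>.
Proof. exact: linearDr. Qed.

Lemma innerBr x y z : '<| x, y - z |> = '<| x, y |> - '<| x, z |>.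
Proof. exact: linearBr. Qed.

Lemma innerZl a x y : '<| a *: x, y |> = a * '<| x, y |>.
Proof. exact: linearZl_LR. Qed.

Lemma innerZr a x y : '<| x, a *: y |> = a^*%R * '<| x, y |>.
Proof. exact: linearZr_LR. Qed.

Lemma inner0r x : '<| x, (0 : H) |> = 0.
Proof. exact: linear0r. Qed.

Lemma innerNl x y : '<| - x, y |> = - '<| x, y |>.
Proof. exact: linearNl. Qed.

Lemma innerNr x y : '<| x, - y |> = - '<| x, y |>.
Proof. exact: linearNr. Qed.

Lemma innerxx x : '<| x, x |> = `|x| ^+ 2.
Proof. exact: inner_norm. Qed.

Lemma innerDd x y : '<| x, y |> = 0 ->
  '<| x + y, x + y |> = '<| x, x |> + '<| y, y |>.
Proof. exact: hnormDd. Qed.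

Lemma innerBd x y : '<| x, y |> = 0 ->
  '<| x - y, x - y |> = '<| x, x |> + '<| y, y |>.
Proof. exact: hnormBd. Qed.

Lemma innerC x y : '<| x, y |> = ('<| y, x |>)^*%R.
Proof. by rewrite hermC expr0 mul1r. Qed.

Lemma inner_eq0C x y : '<| x, y |> = 0 -> '<| y, x |> = 0.
Proof. by move=> xy; rewrite innerC xy rmorph0. Qed.

Lemma cauchy_schwarz x y : `|'<| x, y |>| <= `|x| * `|y|.
Proof.
have [->|yN0] := eqVneq y 0; first by rewrite inner0r !normr0 mulr0.
have ny0 : `|y| ^+ 2 != 0 by rewrite expf_neq0 ?normr_eq0.
rewrite -(@ler_pXn2r _ 2) ?nnegrE ?mulr_ge0// exprMn.
set c := '<| x, y |>; set t := c / `|y| ^+ 2.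
(* t y is the projection of x on the line of y. *)
have ty : '<| x - t *: y, t *: y |> = 0.
  rewrite innerZr innerBl innerZl innerxx divfK//.
  by rewrite subrr mulr0.
have : '<| t *: y, t *: y |> <= '<| x, x |>.
  rewrite -[in leRHS](subrK (t *: y) x) innerDd// lerDr innerxx.
  exact: exprn_ge0.
rewrite !innerxx normrZ exprMn /t normf_div exprMn exprVn.
rewrite [`|_ ^+ 2|]ger0_norm ?exprn_ge0//.
rewrite -[_ ^- 2]/((_ * _)^-1) invfM -!mulrA mulVf// mulr1.
by rewrite mulrA -expr2 ler_pdivrMr ?lt_def ?ny0 ?exprn_ge0// -mulrA.
Qed.

Lemma inner_continuous x :
  continuous (fun y => '<| x, y |> : (F[i] : numFieldType)).
Proof.
move=> y; apply/cvgrPdist_lt => e e0.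
near=> z; rewrite -innerBr; apply: le_lt_trans (cauchy_schwarz _ _) _.
have x1 : 0 < `|x| + 1 by rewrite ltr_wpDl.
apply: (@le_lt_trans _ _ ((`|x| + 1) * `|y - z|)).
  by rewrite ler_wpM2r// lerDl.
rewrite mulrC -ltr_pdivlMr//.
by near: z; apply: cvgr_dist_lt; [exact: cvg_id|exact: divr_gt0].
Unshelve. all: by end_near. Qed.

(** The real part carries the whole inner product on a complex subspace
    ([re_inner_eq0]) while its values are ordered. *)
Definition re_inner x y : F := complex.Re '<| x, y |>.

Lemma re_inner_form : real_semi_inner re_inner.
Proof.
split=> [x y z|x y|t x y|x]; rewrite /re_inner.
- by rewrite innerDl raddfD.
- by rewrite innerC; case: '<| y, x |>.
- by rewrite innerZl; case: '<| x, y |> => a b /=; rewrite mul0r subr0.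
- by have := dnorm_ge0 (@inner F H) x; rewrite lecE => /andP[].
Qed.

Lemma norm_ltE x (e : F) : 0 < e -> (`|x| < e%:C) = (re_inner x x < e ^+ 2).
Proof.
move=> e0; rewrite /re_inner innerxx.
have e1 : 0 <= e%:C by rewrite lecR ltW.
rewrite -(@ltr_pXn2r _ 2) ?nnegrE// -rmorphXn/=.
have : 0 <= `|x| ^+ 2 by rewrite exprn_ge0.
move: (`|x| ^+ 2) => [a b]; rewrite lecE/= => /andP[/eqP -> _].
by rewrite -[a +i* 0]/(a%:C) ltcR.
Qed.

Lemma re_gt0 (e : F[i]) : 0 < e -> exists2 a : F, 0 < a & e = a%:C.
Proof. by case: e => a b; rewrite ltcE/= => /andP[/eqP -> a0]; exists a. Qed.

Lemma re_inner_cvgP (u : nat -> H) l : form_cvg re_inner u l <-> u @ \oo --> l.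
Proof.
split=> [ul|/cvgrPdist_lt ul].
  apply/cvgrPdist_lt => _ /re_gt0[e e0 ->].
  have [N NP] := ul _ (exprn_gt0 2 e0).
  by exists N => // n /NP; rewrite distrC norm_ltE.
move=> e e0; have se : 0 < Num.sqrt e by rewrite sqrtr_gt0.
have [|N _ NP] := ul (Num.sqrt e)%:C; first by rewrite ltcR.
by exists N => n /NP; rewrite distrC norm_ltE// sqr_sqrtr// ltW.
Qed.

Lemma re_inner_cauchy_cvg (u : nat -> H) :
  form_cauchy re_inner u -> exists l : H, u @ \oo --> l.
Proof.
move=> cu; suff : cvg (u @ \oo) by move=> ?; exists (lim (u @ \oo)).
apply/cauchy_cvgP/cauchy_ballP => _ /re_gt0[e e0 ->]; near_simpl.
have [N NP] := cu _ (exprn_gt0 2 e0).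
exists ([set n | (N <= n)%N], [set n | (N <= n)%N]).
  by split; exists N.
move=> [m n] [/= mN nN]; rewrite -ball_normE /ball_/=.
by rewrite norm_ltE//; exact: NP.
Qed.

(** The real part of conj(i) z is the imaginary part of z. *)
Lemma re_eq0 (z : F[i]) : complex.Re z = 0 ->
  complex.Re (('i)^*%R * z) = 0 -> z = 0.
Proof.
by case: z => a b /= ->; rewrite mul0r sub0r mulN1r opprK => ->.
Qed.

Lemma re_inner_eq0 (M : set H) x : submod_closed (mem M) ->
  (forall y, M y -> re_inner x y = 0) -> forall y, M y -> '<| x, y |> = 0.
Proof.
move=> subM xM y My; apply: re_eq0; first exact: xM.
by rewrite -innerZr; exact: xM _ (submodZ subM 'i My).
Qed.

(** Were z nonzero, D would meet the ball of center z and radius |z|, but all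
    vectors orthogonal to z are at distance at least |z| from it. *)
Lemma dense_orthogonal (D : set H) z :
  dense D -> (forall x, D x -> '<| x, z |> = 0) -> z = 0.
Proof.
move=> dD zD; apply/eqP/negP => /negP zN0.
have z0 : 0 < `|z| by rewrite normr_gt0.
have [||x [zx Dx]] := dD (ball z `|z|).
- by exists z; apply: ballxx.
- exact: ball_open.
move: zx; rewrite -ball_normE /ball_/= => zx.
have : `|z| ^+ 2 <= `|z - x| ^+ 2.
  by rewrite -!innerxx innerBd; [rewrite lerDl|exact/inner_eq0C/zD].
by rewrite ler_pXn2r ?nnegrE// => /le_lt_trans /(_ zx); rewrite ltxx.
Qed.

Definition re_inner2 (p q : H * H) : F := re_inner p.1 q.1 + re_inner p.2 q.2.

Lemma re_inner2_form : real_semi_inner re_inner2.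
Proof.
have [D C Z P] := re_inner_form.
split=> [p q s|p q|t p q|p]; rewrite /re_inner2/=.
- by rewrite !D addrACA.
- by rewrite C [X in _ + X]C.
- by rewrite !Z mulrDr.
- exact: addr_ge0.
Qed.

Lemma closed_form_complete (C : set (H * H)) :
  closed C -> form_complete re_inner2 C.
Proof.
move=> clC u Cu cu; have P := form_ge0 re_inner_form.
have [|l1 u1] := @re_inner_cauchy_cvg (fun n => (u n).1).
  move=> e /cu[N NP]; exists N => m n mN nN.
  by apply: le_lt_trans (NP m n mN nN); rewrite /re_inner2/= lerDl.
have [|l2 u2] := @re_inner_cauchy_cvg (fun n => (u n).2).
  move=> e /cu[N NP]; exists N => m n mN nN.
  by apply: le_lt_trans (NP m n mN nN); rewrite /re_inner2/= lerDr.
have u12 : u @ \oo --> (l1, l2).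
  have -> : u = fun n => ((u n).1, (u n).2) by apply/funext => n; case: (u n).
  exact: cvg_pair.
exists (l1, l2); first by apply: (closed_cvg C clC _ _ u12); exact: nearW.
move=> e e0; have e2 : 0 < e / 2 by rewrite divr_gt0.
have [N1 N1P] := (re_inner_cvgP _ _).2 u1 _ e2.
have [N2 N2P] := (re_inner_cvgP _ _).2 u2 _ e2.
exists (maxn N1 N2) => n; rewrite geq_max => /andP[/N1P n1 /N2P n2].
by rewrite [e]splitr /re_inner2/= ltrD.
Qed.

End hilbert.

(** * Adjoints, decompositions and Green's identity *)

Local Notation kernel := Defs.kernel.

Section graphs.
Variables (F : realType) (H : hilbertType F).
Implicit Types A B Q R S T X C : set (H * H).

Lemma adjoint_sub S T : S `<=` T -> adjoint T `<=` adjoint S.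
Proof. by move=> ST p Tp x y /ST; exact: Tp. Qed.

Lemma adjoint_sym S T : S `<=` adjoint T -> T `<=` adjoint S.
Proof.
move=> ST [x y] Txy x' y' /ST /(_ _ _ Txy) /= yx.
by rewrite innerC -yx -innerC.
Qed.

Lemma adjoint_submod T : submod_closed (mem (adjoint T)).
Proof.
apply/submod_closedP; split=> [x y _|a [p1 p2] [q1 q2] Tp Tq x y Txy] /=.
  by rewrite !inner0r.
by rewrite !innerDr !innerZr (Tp _ _ Txy) (Tq _ _ Txy).
Qed.

Lemma adjoint_closed T : closed (adjoint T).
Proof.
have -> : adjoint T = \bigcap_(q in T)
    [set p | '<| q.2, p.1 |> - '<| q.1, p.2 |> = 0 :> (F[i] : numFieldType)].
  apply/seteqP; split=> [p Tp [x y] /Tp/= ->|p Tp x y Txy]; first exact: subrr.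
  by apply/eqP; rewrite -subr_eq0; apply/eqP/(Tp _ Txy).
apply: closed_bigI => -[x y] _ /=.
apply: (@preimage_closed _ _
  (fun p => '<| y, p.1 |> - '<| x, p.2 |> : (F[i] : numFieldType)) [set 0]).
  by move=> p _; apply: cvgB; (apply: continuous_comp;
    [exact: cvg_fst || exact: cvg_snd|exact: inner_continuous]).
by apply/accessible_closed_set1/hausdorff_accessible; exact: norm_hausdorff.
Qed.

Lemma adjoint_functional T x y y' : dense (domain T) ->
  adjoint T (x, y) -> adjoint T (x, y') -> y = y'.
Proof.
move=> dT Ty Ty'; apply/eqP; rewrite -subr_eq0; apply/eqP.
apply: (dense_orthogonal dT) => z [t Tzt].
by rewrite innerBr -(Ty _ _ Tzt) -(Ty' _ _ Tzt) subrr.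
Qed.

Lemma kernel_adjoint_closed T : closed (kernel (adjoint T)).
Proof.
apply: (@preimage_closed _ _ (fun x : H => (x, 0 : H)) (adjoint T)).
  by move=> x _; apply: cvg_pair; [exact: cvg_id|exact: cvg_cst].
exact: adjoint_closed.
Qed.

Lemma kernel_submod T :
  submod_closed (mem T) -> submod_closed (mem (kernel T)).
Proof.
move=> subT; apply/submod_closedP; split=> [|a x y Tx Ty].
  exact: (submod0 subT).
have := submodD subT (submodZ subT a Tx) Ty.
by congr (T (_, _)); rewrite /= scaler0 addr0.
Qed.

Lemma domain_inverse_submod T :
  submod_closed (mem T) -> submod_closed (mem (domain (inverse T))).
Proof.
move=> subT; apply/submod_closedP; split=> [|a y y' [x Tx] [x' Tx']].
  by exists 0; exact: (submod0 subT).
by exists (a *: x + x'); exact: (submodD subT (submodZ subT a Tx) Tx').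
Qed.

(** The kernel of the adjoint is the orthogonal complement of the range. *)
Lemma orthogonal_range T z : submod_closed (mem T) ->
  form_complete (@re_inner F H) (domain (inverse T)) ->
  exists x y v, [/\ T (x, y), adjoint T (v, 0) & z = y + v].
Proof.
move=> subT cT; have subR := domain_inverse_submod subT.
have [y [x Txy] zy] := form_projection (@re_inner_form F H) z subR cT.
exists x, y, (z - y); split=> [//|x' y' Tx'y'/=|]; last by rewrite addrC subrK.
by rewrite inner0r; apply/inner_eq0C/(re_inner_eq0 subR zy); exists x'.
Qed.

Lemma re_inner_le (x y : H) (c : F) : 0 <= c ->
  c%:C * `|x| <= `|y| -> c ^+ 2 * re_inner x x <= re_inner y y.
Proof.
move=> c0 xy; have : (c%:C * `|x|) ^+ 2 <= `|y| ^+ 2.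
  by rewrite ler_pXn2r ?nnegrE// mulr_ge0// lecR.
rewrite exprMn -rmorphXn -!innerxx lecE => /andP[_].
by rewrite /re_inner; case: '<| x, x |> => a b /=; rewrite mul0r subr0.
Qed.

Lemma re_inner_eq (x y : H) : `|x| = `|y| -> re_inner x x = re_inner y y.
Proof. by rewrite /re_inner !innerxx => ->. Qed.

(** If A x_n is a Cauchy sequence, so is x_n by regularity of A, and so is
    B x_n since A and B stretch the differences x_m - x_n equally.  The limit x of
    x_n is in D(B) = D(A) by closedness of B, and |A x_n - A x| = |B x_n - B x|. *)
Lemma range_complete A B : is_operator A -> is_operator B ->
  closed B -> zero_regular A -> domain A = domain B ->
  (forall x a b, A (x, a) -> B (x, b) -> `|a| = `|b|) ->
  form_complete (@re_inner F H) (domain (inverse A)).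
Proof.
move=> [subA _] [subB _] clB [g g0 regA] domAB normAB u /choice[x Ax] cu.
have /choice[y By] n : exists y, B (x n, y).
  by have : domain A (x n); [exists (u n); exact: Ax|rewrite domAB].
have Asub m n : A (x m - x n, u m - u n) by exact: (submodB subA (Ax m) (Ax n)).
have Bsub m n : B (x m - x n, y m - y n) by exact: (submodB subB (By m) (By n)).
have [|x0 xx0] := @re_inner_cauchy_cvg F H x.
  move=> e e0; have [|N NP] := cu (g ^+ 2 * e).
    by rewrite mulr_gt0// exprn_gt0.
  exists N => m n mN nN; rewrite -(ltr_pM2l (exprn_gt0 2 g0)).
  apply: le_lt_trans (NP m n mN nN).
  by apply: re_inner_le; [exact: ltW|exact: regA].
have [|y0 yy0] := @re_inner_cauchy_cvg F H y.
  move=> e /cu[N NP]; exists N => m n mN nN.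
  by rewrite -(re_inner_eq (normAB _ _ _ (Asub m n) (Bsub m n))); exact: NP.
have Bxy0 : B (x0, y0).
  have xy0 : (x n, y n) @[n --> \oo] --> (x0, y0) by exact: cvg_pair.
  by apply: (closed_cvg B clB _ _ xy0); exact: nearW.
have [a Axa] : domain A x0 by rewrite domAB; exists y0.
exists a; first by exists x0.
move=> e /((re_inner_cvgP _ _).2 yy0)[N NP]; exists N => n /NP.
rewrite (@re_inner_eq (u n - a) (y n - y0))//; apply: (normAB (x n - x0)).
  exact: (submodB subA (Ax n) Axa).
exact: (submodB subB (By n) Bxy0).
Qed.

(** z is split as B x0 + v with v in N(B^* ), then v = Q w is lifted by Q; what
    remains of x is annihilated by A^*. *)
Lemma adjoint_decomposition A B Q x z : submod_closed (mem B) ->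
  form_complete (@re_inner F H) (domain (inverse B)) ->
  domain (inverse Q) = setT -> B `<=` Q -> Q `<=` adjoint A ->
  adjoint A (x, z) -> exists x0 z0 w v u,
    [/\ B (x0, z0), Q (w, v), kernel (adjoint B) v, kernel (adjoint A) u &
        (x, z) = (x0 + w + u, z0 + v)].
Proof.
move=> subB cB surjQ BQ QA Axz; have subA := @adjoint_submod A.
have [x0 [z0 [v [Bx0 Bv zE]]]] := orthogonal_range z subB cB.
have [w Qwv] : domain (inverse Q) v by rewrite surjQ.
exists x0, z0, w, v, (x - (x0 + w)); split=> //; last first.
  by rewrite zE [x0 + w + _]addrC subrK.
have /(submodB subA Axz) := submodD subA (QA _ (BQ _ Bx0)) (QA _ Qwv).
by congr (adjoint A (_, _)); rewrite /= zE subrr.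
Qed.

(** With Q = R^* this is T_C; with A, R and pairs (v, u) in place of B, Q and
    (u, v) it is S_C.  Recording the value z0 + v with the vector makes the two
    cases symmetric and leaves A^* and B^* out of the description. *)
Definition extension B Q C : set (H * H) := [set p | exists x0 z0 u v w,
  [/\ B (x0, z0), C (u, v), Q (w, v) & p = (x0 + w + u, z0 + v)]].

Lemma restriction_extension X B Q C : submod_closed (mem X) ->
  (forall x y y', X (x, y) -> X (x, y') -> y = y') ->
  B `<=` X -> Q `<=` X -> (forall u v, C (u, v) -> X (u, 0)) ->
  restriction X [set x | exists x0 u v w, [/\ domain B x0, C (u, v),
    inverse Q (v, w) & x = x0 + w + u]] = extension B Q C.
Proof.
move=> subX funX BX QX CX.
have XE x0 z0 u v w : B (x0, z0) -> C (u, v) -> Q (w, v) ->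
    X (x0 + w + u, z0 + v).
  move=> /BX X0 /CX Xu /QX Xw.
  have := submodD subX (submodD subX X0 Xw) Xu.
  by congr (X (_, _)); rewrite /= addr0.
apply/seteqP; split=> [[x z] [Xxz [x0 [u [v [w [[z0 B0] Cuv Qwv /= xE]]]]]]|].
  exists x0, z0, u, v, w; split=> //; congr (_, _); first by [].
  by apply: funX Xxz _; rewrite xE; exact: XE.
move=> _ [x0 [z0 [u [v [w [B0 Cuv Qwv ->]]]]]]; split; first exact: XE.
by exists x0, u, v, w; split=> //; exists z0.
Qed.

(** The subspace C', with the two components exchanged: its elements are then
    parameters for the pair (B, A), and the construction can be iterated. *)
Definition dual_subspace A B C : set (H * H) := [set p |
  [/\ kernel (adjoint B) p.1, kernel (adjoint A) p.2 &
      forall u v, C (u, v) -> '<| v, p.1 |> = '<| u, p.2 |>]].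

(** Green's identity.  Expanding the left-hand side gives twelve terms: eight
    cancel in pairs by the adjunction relations between A, B, R and Q, two vanish
    since u1 and v2 are orthogonal to the ranges of A and B, and the last two pair
    the parameters. *)
Lemma extension_pairing A B R Q x z y t u1 v1 u2 v2 x0 z0 w1 y0 t0 w2 :
  Q `<=` adjoint R -> R `<=` adjoint B -> Q `<=` adjoint A -> B `<=` Q ->
  A `<=` R ->
  B (x0, z0) -> Q (w1, v1) -> kernel (adjoint A) u1 ->
  A (y0, t0) -> R (w2, u2) -> kernel (adjoint B) v2 ->
  (x, z) = (x0 + w1 + u1, z0 + v1) -> (y, t) = (y0 + w2 + v2, t0 + u2) ->
  '<| z, y |> - '<| x, t |> = '<| v1, v2 |> - '<| u1, u2 |>.
Proof.
move=> QR RB QA BQ AR B0 Q1 A1 A0 R2 B2 [-> ->] [-> ->].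
have e1 := RB _ (AR _ A0) _ _ B0.
have e2 := RB _ R2 _ _ B0.
have e3 := B2 _ _ B0.
have e4 := (adjoint_sym QA) _ A0 _ _ Q1.
have e5 := (adjoint_sym QR) _ R2 _ _ Q1.
have /inner_eq0C e6 : '<| t0, u1 |> = 0 by rewrite (A1 _ _ A0) inner0r.
rewrite /= in e1 e2 e3 e4 e5 e6.
rewrite !innerDl !innerDr e1 e2 e3 e4 e5 e6 inner0r.
ring.
Qed.

(** Since B is a restriction of [extension B Q C], the adjoint of the latter is
    inside B^*, so that its vectors decompose; testing them against the vectors
    w1 + u1 with (u1, v1) in C and Q w1 = v1 puts their parameters in the dual
    subspace. *)
Lemma adjoint_extension A B R Q C :
  submod_closed (mem A) -> B (0, 0) -> C (0, 0) -> Q (0, 0) ->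
  form_complete (@re_inner F H) (domain (inverse A)) ->
  domain (inverse R) = setT -> domain (inverse Q) = setT ->
  A `<=` R -> R `<=` adjoint B -> B `<=` Q -> Q `<=` adjoint A ->
  Q `<=` adjoint R -> (forall u v, C (u, v) -> kernel (adjoint A) u) ->
  adjoint (extension B Q C) = extension A R (dual_subspace A B C).
Proof.
move=> subA B0 C0 Q0 cA surjR surjQ AR RB BQ QA QR CA.
apply/seteqP; split=> [[y t] Eyt|].
  have : adjoint B (y, t).
    apply: adjoint_sub Eyt => -[x z] Bxz; exists x, z, 0, 0, 0.
    by rewrite !addr0.
  move=> /(adjoint_decomposition subA cA surjR AR RB).
  move=> [y0 [t0 [w2 [u2 [v2 [A0 R2 Au2 Bv2 ytE]]]]]].
  exists y0, t0, v2, u2, w2; split=> //; split=> //= u1 v1 C1.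
  have [w1 Q1] : domain (inverse Q) v1 by rewrite surjQ.
  apply/eqP; rewrite -subr_eq0.
  rewrite -(extension_pairing QR RB QA BQ AR B0 Q1 (CA _ _ C1)
    A0 R2 Bv2 erefl ytE).
  rewrite subr_eq0; apply/eqP/Eyt.
  by exists 0, 0, u1, v1, w1.
move=> _ [y0 [t0 [v2 [u2 [w2 [A0 [/= Bv2 Au2 orth] R2 ->]]]]]] x z.
move=> [x0 [z0 [u1 [v1 [w1 [Bx0 C1 Q1 xzE]]]]]].
apply/eqP; rewrite -subr_eq0.
rewrite (extension_pairing QR RB QA BQ AR Bx0 Q1 (CA _ _ C1)
  A0 R2 Bv2 xzE erefl).
by rewrite (orth _ _ C1) subrr.
Qed.

(** If d = (d1, d2) is the component of (u, v) orthogonal to C, then (d2, -d1)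
    is in the dual subspace.  Hence (u, v), being in the bidual, is orthogonal
    to d as well, and d = 0. *)
Lemma dual_subspaceK A B C : submod_closed (mem C) -> closed C ->
  C `<=` defect_space A B -> dual_subspace B A (dual_subspace A B C) = C.
Proof.
move=> subC clC CK; apply/seteqP; split=> [[u v] [/= Au Bv orth]|[u v] Cuv].
  have [[c1 c2] Cc dC] := form_projection (@re_inner2_form F H) (u, v) subC
    (closed_form_complete clC).
  have [/= Ac1 Bc2] := CK _ Cc.
  have K T : submod_closed (mem (kernel (adjoint T))).
    exact/kernel_submod/adjoint_submod.
  set d1 := u - c1; set d2 := v - c2.
  have dP x y : C (x, y) -> '<| d1, x |> + '<| d2, y |> = 0.
    move=> Cxy; apply: re_eq0; first by rewrite raddfD; exact: (dC _ Cxy).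
    rewrite mulrDr -!innerZr raddfD.
    exact: (dC _ (submodZ subC 'i Cxy)).
  have Ad1 : kernel (adjoint A) d1 := submodB (K A) Au Ac1.
  have Bd2 : kernel (adjoint B) d2 := submodB (K B) Bv Bc2.
  have uE : u = d1 + c1 by rewrite subrK.
  have vE : v = d2 + c2 by rewrite subrK.
  clearbody d1 d2.
  have /orth : dual_subspace A B C (d2, - d1).
    split=> //=; first by rewrite -scaleN1r; exact: (submodZ (K A)).
    move=> x y /dP dxy; rewrite innerNr.
    apply/eqP; rewrite -addr_eq0 addrC innerC [X in _ + X]innerC -rmorphD dxy.
    by rewrite rmorph0.
  rewrite /= innerNl => /eqP; rewrite eq_sym -addr_eq0 addrC => /eqP.
  rewrite uE vE !innerDr addrACA (dP _ _ Cc) addr0 !innerxx => /eqP.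
  rewrite paddr_eq0 ?exprn_ge0// !expf_eq0/= !normr_eq0.
  by move=> /andP[/eqP -> /eqP ->]; rewrite !add0r.
split; [by have [] := CK _ Cuv|by have [] := CK _ Cuv|].
move=> v' u' [/= _ _ /(_ _ _ Cuv) e].
by rewrite innerC -e -innerC.
Qed.

End graphs.

(** * Parameters of a proper extension *)

Section proper_extensions.
Variables (F : realType) (H : hilbertType F).
Implicit Types A B Q R S T X C : set (H * H).

(** A continuous g in place of the relation Q^-1 turns the existence of w in
    [parameters] into a preimage under a continuous map. *)
Lemma bounded_inverse_continuous Q : bounded_everywhere_defined (inverse Q) ->
  exists2 g : H -> H, continuous g & forall v w, Q (w, v) <-> w = g v.
Proof.
move=> [[subQ funQ] domQ [M MQ]].
have /choice[g Qg] v : exists w, inverse Q (v, w).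
  by have : domain (inverse Q) v by rewrite domQ.
have gP v w : Q (w, v) <-> w = g v.
  by split=> [Qwv|->]; [exact: (funQ v _ _ Qwv (Qg v))|exact: Qg].
exists g => // v; apply/cvgrPdist_lt => e e0.
have M1 : 0 < (`|M| + 1)%:C by rewrite ltcR ltr_wpDl.
near=> v'.
have /MQ : inverse Q (v - v', g v - g v') := submodB subQ (Qg v) (Qg v').
move=> /le_lt_trans; apply.
apply: (@le_lt_trans _ _ ((`|M| + 1)%:C * `|v - v'|)).
  by rewrite ler_wpM2r// lecR (le_trans (ler_norm M))// lerDl.
rewrite mulrC -ltr_pdivlMr//.
by near: v'; apply: cvgr_dist_lt; [exact: cvg_id|exact: divr_gt0].
Unshelve. all: by end_near. Qed.

(** For Q = R^*, these are the (u, v) such that (R^* )^-1 v + u is in D(T); that T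
    has value v there is automatic for a restriction of A^*, and stating it makes
    the set a preimage of the graph of T. *)
Definition parameters A B Q T : set (H * H) := [set p |
  defect_space A B p /\ exists2 w, Q (w, p.2) & T (w + p.1, p.2)].

Lemma parameters_closed_subspace A B Q T :
  bounded_everywhere_defined (inverse Q) -> submod_closed (mem T) ->
  closed T -> closed_subspace_of (defect_space A B) (parameters A B Q T).
Proof.
move=> bQ subT clT; have [[subQ _] _ _] := bQ.
have [g g_cont gP] := bounded_inverse_continuous bQ.
have K S : submod_closed (mem (kernel (adjoint S))).
  exact/kernel_submod/adjoint_submod.
split=> [p []//||].
  apply/submod_closedP; split=> [|a [u v] [u' v']].
    split; first by split; exact: (submod0 (K _)).
    exists 0; first exact: (submod0 subQ).
    by rewrite /= addr0; exact: (submod0 subT).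
  move=> [[/= Au Bv] [w Qw Tw]] [[/= Au' Bv'] [w' Qw' Tw']].
  split; first by split; exact: (submodD (K _) (submodZ (K _) a _) _).
  exists (a *: w + w').
    exact: (submodD subQ (submodZ subQ a (Qw : inverse Q (v, w)))
      (Qw' : inverse Q (v', w'))).
  have := submodD subT (submodZ subT a Tw) Tw'.
  by congr (T (_, _)); rewrite /= scalerDr addrACA.
have -> : parameters A B Q T = (fst @^-1` kernel (adjoint A)) `&`
    (snd @^-1` kernel (adjoint B)) `&` ((fun p => (g p.2 + p.1, p.2)) @^-1` T).
  apply/seteqP; split=> [[u v] [[/= Au Bv] [w /gP-> Tw]]//|].
  by move=> [u v] [[/= Au Bv] Tg]; split=> //; exists (g v) => //; apply/gP.
apply: closedI; first apply: closedI.
- apply: (preimage_closed _ (@kernel_adjoint_closed _ _ A)).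
  by move=> p _; exact: cvg_fst.
- apply: (preimage_closed _ (@kernel_adjoint_closed _ _ B)).
  by move=> p _; exact: cvg_snd.
apply: (preimage_closed _ clT) => p _; apply: cvg_pair; last exact: cvg_snd.
apply: cvgD; last exact: cvg_fst.
by apply: continuous_comp; [exact: cvg_snd|exact: g_cont].
Qed.

(** In the decomposition x = x0 + w + u of a vector of D(T), the vector w + u is
    itself in D(T) because B is a restriction of T. *)
Lemma extension_parameters A B Q T :
  is_operator (inverse Q) -> submod_closed (mem T) -> submod_closed (mem B) ->
  form_complete (@re_inner F H) (domain (inverse B)) ->
  domain (inverse Q) = setT -> B `<=` Q -> Q `<=` adjoint A ->
  B `<=` T -> T `<=` adjoint A ->
  T = extension B Q (parameters A B Q T).
Proof.
move=> [_ funQ] subT subB cB surjQ BQ QA BT TA.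
apply/seteqP; split=> [[x z] Txz|].
  have [x0 [z0 [w [v [u [B0 Qw Bv Au xzE]]]]]] :=
    adjoint_decomposition subB cB surjQ BQ QA (TA _ Txz).
  exists x0, z0, u, v, w; split=> //; split=> //; exists w => //=.
  have : T (x - x0, z - z0) := submodB subT Txz (BT _ B0).
  by case: xzE => -> ->; rewrite -(addrA x0) !(addrC _ (- _)) !addKr.
move=> _ [x0 [z0 [u [v [w [B0 [_ [w' Qw' Tw]] Qw ->]]]]]].
have := submodD subT (BT _ B0) Tw.
by congr (T (_, _)); rewrite /= (funQ _ _ _ Qw' Qw) addrA.
Qed.

End proper_extensions.

Theorem lemma9 (F : realType) (H : hilbertType F) (A B R : set (H * H))
    (pairAB : adjoint_pair A B)
    (regA : zero_regular A) (regB : zero_regular B)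
    (closedB : closed B) (normalB : formally_normal B)
    (domAB : domain A = domain B)
    (assocR : associated A B R) :
  [/\ (forall C, closed_subspace_of (defect_space A B) C ->
         proper_extension A B (T_ A B R C)),
      (forall T, proper_extension A B T ->
         exists2 C, closed_subspace_of (defect_space A B) C & T = T_ A B R C)
    & (forall C, closed_subspace_of (defect_space A B) C ->
         adjoint (T_ A B R C) = S_ A B R (prime_subspace A B C) /\
         adjoint (S_ A B R (prime_subspace A B C)) = T_ A B R C)].
Proof.
have [[opA dA] [opB dB] _] := pairAB.
have [_ bR bQ [AR RB] [BQ QA]] := assocR.
have [_ surjR _] := bR; have [opQ surjQ _] := bQ.
have [subA _] := opA; have [subB _] := opB.
have AB' : A `<=` adjoint B := subset_trans AR RB.
have BA' : B `<=` adjoint A := subset_trans BQ QA.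
have cA : form_complete (@re_inner F H) (domain (inverse A)).
  apply: (range_complete opA opB closedB regA domAB) => x a b Axa Bxb.
  by have [_ _ _ /(_ _ _ _ Bxb (AB' _ Axa))] := normalB.
have cB : form_complete (@re_inner F H) (domain (inverse B)).
  apply: (range_complete opB opB closedB regB erefl) => x a b Ba Bb.
  by have [_ /(_ _ _ _ Ba Bb) ->] := opB.
have TE C : C `<=` defect_space A B ->
    T_ A B R C = extension B (adjoint R) C.
  move=> CK; apply: restriction_extension => //.
  - exact: adjoint_submod.
  - by move=> x y y'; exact: adjoint_functional.
  - by move=> u v /CK[].
have SE C : C `<=` defect_space A B ->
    S_ A B R (prime_subspace A B C) = extension A R (dual_subspace A B C).
  move=> CK; rewrite -(@restriction_extension _ _ (adjoint B)) => //.
  - rewrite /S_; congr (restriction _ _); apply/seteqP; split=> y.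
      move=> [y0 [u [v [w [A0 [[/= Au Bv] uv] Rw ->]]]]].
      by exists y0, v, u, w; split=> //; split=> // u' v' /uv.
    move=> [y0 [v [u [w [A0 [/= Bv Au uv] Rw ->]]]]].
    by exists y0, u, v, w; split=> //; split=> // u' v' /uv.
  - exact: adjoint_submod.
  - by move=> x y y'; exact: adjoint_functional.
  - by move=> u v [].
have B0 : B (0, 0) := submod0 subB.
have A0 : A (0, 0) := submod0 subA.
have adjT C : closed_subspace_of (defect_space A B) C ->
    adjoint (T_ A B R C) = S_ A B R (prime_subspace A B C).
  move=> [CK subC clC]; rewrite TE// SE//.
  apply: adjoint_extension => //; [exact: (submod0 subC)|exact: BQ|].
  by move=> u v /CK[].
have adjS C : closed_subspace_of (defect_space A B) C ->
    adjoint (S_ A B R (prime_subspace A B C)) = T_ A B R C.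
  move=> [CK subC clC]; rewrite TE// SE//.
  rewrite -[in RHS](dual_subspaceK subC clC CK).
  apply: adjoint_extension => //; last by move=> v u [].
  - split; [exact/(submod0 (kernel_submod (@adjoint_submod _ _ _)))
      |exact/(submod0 (kernel_submod (@adjoint_submod _ _ _)))|].
    by move=> u v _ /=; rewrite !inner0r.
  - exact: AR.
  - exact: adjoint_sym.
split=> [C CP|T [[subT _] clT BT TA]|C CP].
- have TA : T_ A B R C `<=` adjoint A by move=> p [].
  split=> //.
  + split; first by rewrite -adjS//; exact: adjoint_submod.
    by move=> x y y' /TA Ty /TA Ty'; exact: adjoint_functional Ty Ty'.
  + by rewrite -adjS//; exact: adjoint_closed.
  have [CK subC _] := CP; rewrite TE// => -[x z] Bxz.
  exists x, z, 0, 0, 0; rewrite !addr0; split=> //; first exact: (submod0 subC).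
  exact: BQ.
- have PC : closed_subspace_of (defect_space A B) (parameters A B (adjoint R) T).
    exact: parameters_closed_subspace.
  exists (parameters A B (adjoint R) T) => //.
  by rewrite TE; [exact: extension_parameters|have [] := PC].
- by split; [exact: adjT|exact: adjS].
Qed.
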